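(* There exists a real analytic function $g:\mathbf{R}^2\to\mathbf{R}$, $(x,y)\mapsto g(x,y)$, whose graph $t=g(x,y)$ in the Lorentz-Minkowski space-time $\mathbf{R}^3_1$ satisfies the following properties, where $\Sigma_g\subset\mathbf{R}^2$ denotes the set of non-degenerate points of type change of the graph of $g$: (1) $\Sigma_g$ is non-empty, and the induced metric of the graph of $g$ is non-degenerate at every point of $\mathbf{R}^2\setminus\Sigma_g$; (2) the mean curvature function $H$ of the graph of $g$ is bounded on $\mathbf{R}^2\setminus\Sigma_g$; (3) the mean curvature vector field $H\nu$, defined on $\mathbf{R}^2\setminus\Sigma_g$, can be extended real analytically to $\Sigma_g$ (that is, it is the restriction of a real analytic map $\mathbf{R}^2\to\mathbf{R}^3_1$), and the extension does not vanish at any point of $\Sigma_g$.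
   Context: $\mathbf{R}^3_1$ is $\mathbf{R}^3$ with coordinates $(t,x,y)$ and the Lorentzian metric $-dt^2+dx^2+dy^2$. For a real analytic function $g$ on $\mathbf{R}^2$, its graph is parametrized by $(x,y)\mapsto(g(x,y),x,y)$. Put $$B:=1-g_x^2-g_y^2 .$$ $B$ is the determinant of the induced metric in the coordinates $(x,y)$; the graph is space-like where $B>0$, time-like where $B<0$, and the induced metric is degenerate exactly where $B=0$. A point $p$ is a non-degenerate point of type change if $B(p)=0$ and $\nabla B(p)=(B_x(p),B_y(p))\neq(0,0)$. Where $B\ne0$, the unit normal vector and the mean curvature function are $$\nu=\frac{1}{\sqrt{|B|}}(1,g_x,g_y),\qquad H=\frac{(g_x^2-1)g_{yy}-2g_xg_yg_{xy}+(g_y^2-1)g_{xx}}{2|B|^{3/2}},$$ and the mean curvature vector field is $H\nu$. *)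

(* Defs.v *)
From Stdlib Require Import Reals.
From Coquelicot Require Import Coquelicot.
Open Scope R_scope.

(* The double series of the [a i j * h^i * k^j] converges absolutely, with sum
   [l]. It is summed along the diagonals [i + j = n]; the order is immaterial
   because of absolute convergence. [sum_n u n] is [u 0 + ... + u n]. *)
Definition is_pseries_2d (a : nat -> nat -> R) (h k l : R) : Prop :=
  let term i j := a i j * h ^ i * k ^ j in
  ex_series (fun n => sum_n (fun i => Rabs (term i (n - i)%nat)) n) /\
  is_series (fun n => sum_n (fun i => term i (n - i)%nat) n) l.

Definition real_analytic (f : R -> R -> R) : Prop :=
  forall x0 y0 : R, exists (a : nat -> nat -> R) (r : posreal),
    forall x y : R, Rabs (x - x0) < r -> Rabs (y - y0) < r ->
      is_pseries_2d a (x - x0) (y - y0) (f x y).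

Definition R31 : Type := (R * R * R)%type.

Definition coord_t (v : R31) : R := fst (fst v).
Definition coord_x (v : R31) : R := snd (fst v).
Definition coord_y (v : R31) : R := snd v.

Definition lorentz (v w : R31) : R :=
  - (coord_t v * coord_t w) + coord_x v * coord_x w + coord_y v * coord_y w.

Definition scale (c : R) (v : R31) : R31 :=
  (c * coord_t v, c * coord_x v, c * coord_y v).

Definition real_analytic_map (F : R -> R -> R31) : Prop :=
  real_analytic (fun x y => coord_t (F x y)) /\
  real_analytic (fun x y => coord_x (F x y)) /\
  real_analytic (fun x y => coord_y (F x y)).

(* [partial_derive m k f] differentiates [k] times in the second variable, then
   [m] times in the first. *)
Definition d_x (f : R -> R -> R) : R -> R -> R := partial_derive 1 0 f.
Definition d_y (f : R -> R -> R) : R -> R -> R := partial_derive 0 1 f.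
Definition d_xx (f : R -> R -> R) : R -> R -> R := partial_derive 2 0 f.
Definition d_xy (f : R -> R -> R) : R -> R -> R := partial_derive 1 1 f.
Definition d_yy (f : R -> R -> R) : R -> R -> R := partial_derive 0 2 f.

Definition graph (g : R -> R -> R) (x y : R) : R31 := (g x y, x, y).

(* The differential at [(x, y)] of a map [F], applied to [u]. *)
Definition differential (F : R -> R -> R31) (x y : R) (u : R * R) : R31 :=
  let d f := d_x f x y * fst u + d_y f x y * snd u in
  (d (fun x y => coord_t (F x y)),
   d (fun x y => coord_x (F x y)),
   d (fun x y => coord_y (F x y))).

Definition induced_metric (g : R -> R -> R) (x y : R) (u v : R * R) : R :=
  lorentz (differential (graph g) x y u) (differential (graph g) x y v).

Definition induced_metric_nondegenerate (g : R -> R -> R) (x y : R) : Prop :=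
  forall u : R * R,
    (forall v : R * R, induced_metric g x y u v = 0) -> u = (0, 0).

Definition B (g : R -> R -> R) (x y : R) : R :=
  1 - (d_x g x y) ^ 2 - (d_y g x y) ^ 2.

(* Non-degenerate points of type change. *)
Definition Sigma (g : R -> R -> R) (x y : R) : Prop :=
  B g x y = 0 /\ (d_x (B g) x y, d_y (B g) x y) <> (0, 0).

(* [unit_normal] and [mean_curvature] are meaningful only where [B] is nonzero;
   elsewhere their values are junk. *)
Definition unit_normal (g : R -> R -> R) (x y : R) : R31 :=
  scale (/ sqrt (Rabs (B g x y))) (1, d_x g x y, d_y g x y).

Definition mean_curvature (g : R -> R -> R) (x y : R) : R :=
  ((d_x g x y ^ 2 - 1) * d_yy g x y
   - 2 * d_x g x y * d_y g x y * d_xy g x y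
   + (d_y g x y ^ 2 - 1) * d_xx g x y)
  / (2 * Rpower (Rabs (B g x y)) (3 / 2)).

Definition mean_curvature_vector (g : R -> R -> R) (x y : R) : R31 :=
  scale (mean_curvature g x y) (unit_normal g x y).

(* Main.v *)
Require Import Defs.
From Stdlib Require Import Reals Lra Lia Wf_nat IndefiniteDescription.
From Stdlib Require Import FunctionalExtensionality.
From Coquelicot Require Import Coquelicot.
Open Scope R_scope.

(** The graph of [x tanh y] has zero mean curvature and changes type along
    [x = ± cosh y]. Put [u = x / cosh y = tan (theta / 2)], [q = 1 / cosh y],
    [c = cos theta], [s = sin theta], and perturb it to
    [g = x tanh y + eps q c^3]. The zero set of [c] is the old type change set.
    The symbol of the mean curvature operator degenerates in the direction
    transverse to it, so a perturbation of order 3 in [c] changes the numerator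
    [N] of [H] only at order 2: one finds [B = 2 c q^2 P / (1 + c)] with [P]
    close to 1, and [N = q^3 c^2 R] with [R = -9 eps] on [c = 0]. Hence [N / B^2],
    and with it [H nu], is analytic and nonzero there. Since [P - 1] and [R]
    are polynomials in the bounded functions [c], [s], [q], [tanh y], the set
    [B = 0] is exactly [c = 0], and [H] is bounded on the whole plane.

    Real analyticity is handled through expansions into homogeneous polynomials
    whose coefficient norms grow at most geometrically; this class is closed
    under sums, products and inverses. *)

(** * Real analytic functions of two variables *)

(* [homog n c p]: the function [p] is a homogeneous polynomial of degree [n]
   whose coefficients have absolute values of sum at most [c]. *)
Inductive homog : nat -> R -> (R -> R -> R) -> Prop :=
| homog_monomial (i j : nat) (a c : R) (p : R -> R -> R) :
    Rabs a <= c -> (forall h k, p h k = a * h ^ i * k ^ j) ->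
    homog (i + j) c p
| homog_add (n : nat) (c d e : R) (p q r : R -> R -> R) :
    homog n c p -> homog n d q -> c + d <= e ->
    (forall h k, r h k = p h k + q h k) -> homog n e r.

Lemma homog_ge0 n c p : homog n c p -> 0 <= c.
Proof.
  induction 1 as [i j a c p Ha Hp | n c d e p q r _ Hc _ Hd Hcd _]; [|lra].
  pose proof (Rabs_pos a). lra.
Qed.

Lemma homog_zero n c p : 0 <= c -> (forall h k, p h k = 0) -> homog n c p.
Proof.
  intros Hc Hp. apply (homog_monomial 0 n 0).
  - now rewrite Rabs_R0.
  - intros. rewrite Hp. ring.
Qed.

(** A zero summand in [homog_add] absorbs both the slack in the bound and the passage to a pointwise
    equal function. *)
Lemma homog_weaken n c d p q :
  homog n c p -> c <= d -> (forall h k, q h k = p h k) -> homog n d q.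
Proof.
  intros Hp Hcd Hq.
  apply (homog_add n c 0 d p (fun _ _ => 0)); [assumption | | lra |].
  - apply homog_zero; [lra | reflexivity].
  - intros. rewrite Hq. ring.
Qed.

(** The sum of the absolute values of the coefficients is submultiplicative; the induction
    distributes the product over the two derivations. *)
Lemma homog_mult n m c d p q :
  homog n c p -> homog m d q ->
  homog (n + m) (c * d) (fun h k => p h k * q h k).
Proof.
  intros Hp Hq.
  induction Hp as [i j a c p Ha Hp | n c d1 e p p' r Hp IHp Hp' IHp' Hce Hr].
  - induction Hq as [i' j' b d q Hb Hq | m d d1 e q q' r Hq IHq Hq' IHq' Hde Hr].
    + replace (i + j + (i' + j'))%nat with ((i + i') + (j + j'))%nat by lia.
      apply (homog_monomial _ _ (a * b)).
      * rewrite Rabs_mult. apply Rmult_le_compat; auto using Rabs_pos.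
      * intros. rewrite Hp, Hq, !pow_add. ring.
    + apply (homog_add _ _ _ _ _ _ _ IHq IHq').
      * rewrite <- Rmult_plus_distr_l. apply Rmult_le_compat_l; [|assumption].
        pose proof (Rabs_pos a). lra.
      * intros. rewrite Hr. ring.
  - apply (homog_add _ _ _ _ _ _ _ IHp IHp').
    + rewrite <- Rmult_plus_distr_r. apply Rmult_le_compat_r; [|assumption].
      now apply homog_ge0 in Hq.
    + intros. rewrite Hr. ring.
Qed.

Lemma homog_scal n c b p :
  homog n c p -> homog n (Rabs b * c) (fun h k => b * p h k).
Proof.
  intros Hp. apply (homog_mult 0 n _ _ (fun _ _ => b)); [|assumption].
  apply (homog_monomial 0 0 b); [apply Rle_refl | intros; ring].
Qed.

Lemma homog_sum n (c : nat -> R) (p : nat -> R -> R -> R) N :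
  (forall m, (m <= N)%nat -> homog n (c m) (p m)) ->
  homog n (sum_f_R0 c N) (fun h k => sum_f_R0 (fun m => p m h k) N).
Proof.
  induction N as [|N IH]; intros H; simpl.
  - now apply H.
  - apply (homog_add n (sum_f_R0 c N) (c (S N)) _
             (fun h k => sum_f_R0 (fun m => p m h k) N) (p (S N))).
    + apply IH. intros. apply H. lia.
    + now apply H.
    + lra.
    + reflexivity.
Qed.

Lemma homog_bound n c p h k m :
  homog n c p -> Rabs h <= m -> Rabs k <= m -> Rabs (p h k) <= c * m ^ n.
Proof.
  intros Hp Hh Hk.
  induction Hp as [i j a c p Ha Hp | n c d e p q r Hp IHp Hq IHq Hce Hr].
  - rewrite Hp, !Rabs_mult, <- !RPow_abs, pow_add, Rmult_assoc.
    apply Rmult_le_compat; auto using Rabs_pos.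
    + apply Rmult_le_pos; apply pow_le, Rabs_pos.
    + apply Rmult_le_compat; try (apply pow_le, Rabs_pos);
        apply pow_incr; auto using Rabs_pos.
  - rewrite Hr. apply Rle_trans with (1 := Rabs_triang _ _).
    apply Rle_trans with ((c + d) * m ^ n); [lra|].
    apply Rmult_le_compat_r; [|assumption].
    apply pow_le. pose proof (Rabs_pos h). lra.
Qed.

Lemma homog_coef n c p :
  homog n c p ->
  exists a : nat -> R,
    sum_n (fun i => Rabs (a i)) n <= c /\
    forall h k, p h k = sum_n (fun i => a i * h ^ i * k ^ (n - i)) n.
Proof.
  induction 1 as [i j b c p Hb Hp | n c d e p q r _ [a [Ha Hpa]] _ [b [Hb Hqb]] Hce Hr].
  (* The coefficient sequence of a monomial is a Kronecker delta; [single] evaluates sums having at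
     most one nonzero term. *)
  - assert (single : forall (u : nat -> R) N,
      (forall m, (m <= N)%nat -> m <> i -> u m = 0) ->
      sum_n u N = if Nat.leb i N then u i else 0).
    { intros u. induction N as [|N IH]; intros Hu.
      - rewrite sum_O. destruct (Nat.leb_spec i 0) as [H|H].
        + now replace i with 0%nat by lia.
        + apply Hu; lia.
      - rewrite sum_Sn, IH by (intros; apply Hu; lia).
        unfold plus; simpl.
        destruct (Nat.leb_spec i N), (Nat.leb_spec i (S N)); try lia.
        + rewrite (Hu (S N)) by lia. ring.
        + replace i with (S N) by lia. ring.
        + rewrite (Hu (S N)) by lia. ring. }
    exists (fun m => if Nat.eqb m i then b else 0).
    assert (Hi : Nat.leb i (i + j) = true) by (apply Nat.leb_le; lia).
    split.
    + rewrite single, Hi, Nat.eqb_refl; [assumption|].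
      intros m _ Hm. apply Nat.eqb_neq in Hm. now rewrite Hm, Rabs_R0.
    + intros h k. rewrite single, Hi, Nat.eqb_refl, Hp.
      * now replace (i + j - i)%nat with j by lia.
      * intros m _ Hm. apply Nat.eqb_neq in Hm. rewrite Hm. ring.
  - exists (fun i => a i + b i). split.
    + apply Rle_trans with (2 := Hce).
      apply Rle_trans with
        (sum_n (fun i => Rabs (a i)) n + sum_n (fun i => Rabs (b i)) n); [|lra].
      rewrite <- (sum_n_plus (G := R_AbelianMonoid)).
      rewrite !sum_n_Reals. apply sum_Rle. intros. apply Rabs_triang.
    + intros h k. rewrite Hr, Hpa, Hqb, <- (sum_n_plus (G := R_AbelianMonoid)).
      apply sum_n_ext. intros. unfold plus; simpl. ring.
Qed.

(** The constant [K] serves twice, as growth rate of the norms and as inverse radius. With this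
    choice [homog_bound] gives absolute convergence on the whole square where the sum is required to
    be [f]. *)
Definition analytic_at (f : R -> R -> R) (x0 y0 : R) : Prop :=
  exists (M K : R) (p : nat -> R -> R -> R),
    0 < K /\ (forall n, homog n (M * K ^ n) (p n)) /\
    forall h k, K * Rabs h < 1 -> K * Rabs k < 1 ->
      is_series (fun n => p n h k) (f (x0 + h) (y0 + k)).

Definition analytic (f : R -> R -> R) : Prop := forall x0 y0, analytic_at f x0 y0.

Lemma ex_series_geom_bound (u : nat -> R) M q :
  Rabs q < 1 -> (forall n, Rabs (u n) <= M * q ^ n) ->
  ex_series (fun n => Rabs (u n)).
Proof.
  intros Hq Hu.
  apply (ex_series_le (K := R_AbsRing) (V := R_CompleteNormedModule) _
           (fun n => M * q ^ n)).
  - intros n. unfold norm; simpl. rewrite Rabs_Rabsolu. apply Hu.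
  - apply (ex_series_scal_l M (fun n => q ^ n)). now apply ex_series_geom.
Qed.

Lemma homog_ex_series (p : nat -> R -> R -> R) M K h k :
  0 < K -> (forall n, homog n (M * K ^ n) (p n)) ->
  K * Rabs h < 1 -> K * Rabs k < 1 ->
  ex_series (fun n => Rabs (p n h k)).
Proof.
  intros HK Hp Hh Hk.
  pose proof (Rmax_l (Rabs h) (Rabs k)) as Hl.
  pose proof (Rmax_r (Rabs h) (Rabs k)) as Hr.
  assert (Hm : K * Rmax (Rabs h) (Rabs k) < 1)
    by (now apply Rmax_case).
  apply (ex_series_geom_bound _ M (K * Rmax (Rabs h) (Rabs k))).
  - rewrite Rabs_pos_eq; [assumption|].
    pose proof (Rabs_pos h). apply Rmult_le_pos; lra.
  - intros n. rewrite Rpow_mult_distr, <- Rmult_assoc.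
    now apply homog_bound.
Qed.

Lemma analytic_real_analytic f : analytic f -> real_analytic f.
Proof.
  intros Hf x0 y0. destruct (Hf x0 y0) as (M & K & p & HK & Hp & Hs).
  (* Choice selects one coefficient sequence for each degree. *)
  destruct (functional_choice (fun n a =>
     sum_n (fun i => Rabs (a i)) n <= M * K ^ n /\
     forall h k, p n h k = sum_n (fun i => a i * h ^ i * k ^ (n - i)) n))
    as [a Ha].
  { intros n. now apply homog_coef. }
  assert (Hr : 0 < / K) by now apply Rinv_0_lt_compat.
  (* The coefficient of [h ^ i * k ^ j] sits in the component of degree [i + j]. The absolute double
     series, summed along diagonals, is dominated by the geometric series of ratio
     [K * max(|h|, |k|)]. *)
  exists (fun i j => a (i + j)%nat i), (mkposreal _ Hr). simpl.
  intros x y Hx Hy.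
  set (h := x - x0) in *. set (k := y - y0) in *.
  assert (scaled : forall t, Rabs t < / K -> K * Rabs t < 1).
  { intros t Ht. apply (Rmult_lt_compat_l K) in Ht; [|assumption].
    rewrite Rinv_r in Ht; lra. }
  apply scaled in Hx, Hy.
  replace x with (x0 + h) by (unfold h; ring).
  replace y with (y0 + k) by (unfold k; ring).
  split.
  - pose proof (Rmax_l (Rabs h) (Rabs k)) as Hl'.
    pose proof (Rmax_r (Rabs h) (Rabs k)) as Hr'.
    assert (Hm : K * Rmax (Rabs h) (Rabs k) < 1)
      by (now apply Rmax_case).
    set (m := Rmax (Rabs h) (Rabs k)) in *.
    pose proof (Rabs_pos h).
    assert (Hm0 : 0 <= m) by lra.
    apply ex_series_ext with (fun n => Rabs (sum_n
      (fun i => Rabs (a n i * h ^ i * k ^ (n - i))) n)).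
    { intros n. rewrite Rabs_pos_eq.
      - apply sum_n_ext_loc. intros i Hi.
        now replace (i + (n - i))%nat with n by lia.
      - rewrite sum_n_Reals. apply cond_pos_sum. intros. apply Rabs_pos. }
    apply (ex_series_geom_bound _ M (K * m)).
    + rewrite Rabs_pos_eq; [assumption|]. apply Rmult_le_pos; lra.
    + intros n. destruct (Ha n) as [Han _].
      rewrite Rabs_pos_eq.
      2:{ rewrite sum_n_Reals. apply cond_pos_sum. intros. apply Rabs_pos. }
      apply Rle_trans with (sum_n (fun i => Rabs (a n i)) n * m ^ n).
      * rewrite !sum_n_Reals, Rmult_comm, scal_sum.
        apply sum_Rle. intros i Hi.
        rewrite !Rabs_mult, Rmult_assoc.
        apply Rmult_le_compat_l; [apply Rabs_pos|].
        replace n with (i + (n - i))%nat at 2 by lia.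
        rewrite pow_add, <- !RPow_abs.
        apply Rmult_le_compat; try (apply pow_le, Rabs_pos);
          apply pow_incr; split; auto using Rabs_pos.
      * rewrite Rpow_mult_distr, <- Rmult_assoc.
        apply Rmult_le_compat_r; [now apply pow_le | assumption].
  - apply is_series_ext with (fun n => p n h k); [|now apply Hs].
    intros n. destruct (Ha n) as [_ ->]. apply sum_n_ext_loc.
    intros i Hi. now replace (i + (n - i))%nat with n by lia.
Qed.

(** * Sums, products and elementary examples *)

Lemma analytic_ext f g : (forall x y, f x y = g x y) -> analytic f -> analytic g.
Proof.
  intros Hfg Hf x0 y0. destruct (Hf x0 y0) as (M & K & p & HK & Hp & Hs).
  exists M, K, p. repeat split; auto.
  intros h k Hh Hk. rewrite <- Hfg. now apply Hs.
Qed.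

Lemma homog_geom_weaken M K L n p :
  0 < K <= L -> homog n (M * K ^ n) p -> homog n (M * L ^ n) p.
Proof.
  intros HKL Hp. apply homog_weaken with (1 := Hp); [|reflexivity].
  assert (HM : 0 <= M).
  { pose proof (homog_ge0 _ _ _ Hp) as H0.
    apply Rmult_le_reg_r with (K ^ n); [apply pow_lt; lra | lra]. }
  apply Rmult_le_compat_l; [assumption|]. apply pow_incr. lra.
Qed.

Lemma analytic_at_common f g x0 y0 :
  analytic_at f x0 y0 -> analytic_at g x0 y0 ->
  exists M N K p q,
    0 < K /\ (forall n, homog n (M * K ^ n) (p n)) /\
    (forall n, homog n (N * K ^ n) (q n)) /\
    forall h k, K * Rabs h < 1 -> K * Rabs k < 1 ->
      is_series (fun n => p n h k) (f (x0 + h) (y0 + k)) /\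
      is_series (fun n => q n h k) (g (x0 + h) (y0 + k)).
Proof.
  intros (M & K & p & HK & Hp & Hps) (N & L & q & HL & Hq & Hqs).
  exists M, N, (Rmax K L), p, q.
  pose proof (Rmax_l K L). pose proof (Rmax_r K L).
  assert (mono : forall a t, 0 < a <= Rmax K L ->
                 Rmax K L * Rabs t < 1 -> a * Rabs t < 1).
  { intros a t Ha. apply Rle_lt_trans.
    apply Rmult_le_compat_r; [apply Rabs_pos | lra]. }
  split; [lra | split; [|split]].
  - intros n. apply (homog_geom_weaken M K); auto.
  - intros n. apply (homog_geom_weaken N L); auto.
  - intros h k Hh Hk. split; [apply Hps | apply Hqs]; auto.
Qed.

Lemma analytic_plus f g :
  analytic f -> analytic g -> analytic (fun x y => f x y + g x y).
Proof.
  intros Hf Hg x0 y0.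
  destruct (analytic_at_common f g x0 y0 (Hf x0 y0) (Hg x0 y0))
    as (M & N & K & p & q & HK & Hp & Hq & Hs).
  exists (M + N), K, (fun n h k => p n h k + q n h k).
  split; [assumption | split].
  - intros n. apply (homog_add _ _ _ _ _ _ _ (Hp n) (Hq n)); [lra | reflexivity].
  - intros h k Hh Hk. destruct (Hs h k Hh Hk) as [Hsp Hsq].
    exact (is_series_plus _ _ _ _ Hsp Hsq).
Qed.

(** Degree [n] of the Cauchy product collects [n + 1] products, each of norm at most
    [M * N * K ^ n]. Doubling [K] absorbs the factor [n + 1]. *)
Lemma analytic_mult f g :
  analytic f -> analytic g -> analytic (fun x y => f x y * g x y).
Proof.
  intros Hf Hg x0 y0.
  destruct (analytic_at_common f g x0 y0 (Hf x0 y0) (Hg x0 y0))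
    as (M & N & K & p & q & HK & Hp & Hq & Hs).
  exists (M * N), (2 * K),
    (fun n h k => sum_f_R0 (fun m => p m h k * q (n - m)%nat h k) n).
  split; [lra | split].
  - intros n.
    apply homog_weaken with
      (c := sum_f_R0 (fun m => M * K ^ m * (N * K ^ (n - m))) n)
      (p := fun h k => sum_f_R0 (fun m => p m h k * q (n - m)%nat h k) n);
      [|  | reflexivity].
    + apply homog_sum with (p := fun m h k => p m h k * q (n - m)%nat h k).
      intros m Hm. replace n with (m + (n - m))%nat at 1 by lia.
      now apply homog_mult.
    + rewrite (sum_eq _ (fun _ => M * N * K ^ n)).
      2:{ intros m Hm. replace n with (m + (n - m))%nat at 2 by lia.
          rewrite pow_add. ring. }
      rewrite sum_cte, Rpow_mult_distr, (Rmult_comm (2 ^ n)), <- Rmult_assoc.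
      apply Rmult_le_compat_l.
      * pose proof (homog_ge0 _ _ _ (Hp 0%nat)) as HM.
        pose proof (homog_ge0 _ _ _ (Hq 0%nat)) as HN. simpl in HM, HN.
        apply Rmult_le_pos; [apply Rmult_le_pos; lra | apply pow_le; lra].
      (* Bernoulli's inequality: [1 + n <= 2 ^ n]. *)
      * pose proof (poly n 1 Rlt_0_1) as Hb. rewrite S_INR.
        replace (1 + 1) with 2 in Hb by ring. lra.
  - intros h k Hh Hk.
    pose proof (Rabs_pos h). pose proof (Rabs_pos k).
    assert (Hh' : K * Rabs h < 1) by nra.
    assert (Hk' : K * Rabs k < 1) by nra.
    destruct (Hs h k Hh' Hk') as [Hsp Hsq].
    apply (is_series_mult (fun n => p n h k) (fun n => q n h k)); try assumption.
    + now apply (homog_ex_series p M K).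
    + now apply (homog_ex_series q N K).
Qed.

Lemma is_series_finite (u : nat -> R) N :
  (forall n, (N < n)%nat -> u n = 0) -> is_series u (sum_n u N).
Proof.
  intros Hu. change (is_lim_seq (sum_n u) (sum_n u N)).
  apply is_lim_seq_ext_loc with (fun _ => sum_n u N).
  - exists N. intros n Hn. induction Hn as [|n Hn IH]; [reflexivity|].
    rewrite sum_Sn, <- IH, Hu by lia. symmetry. apply Rplus_0_r.
  - apply is_lim_seq_const.
Qed.

Lemma analytic_affine (a b c : R) : analytic (fun x y => a + b * x + c * y).
Proof.
  intros x0 y0.
  exists (Rabs (a + b * x0 + c * y0) + Rabs b + Rabs c), 1,
    (fun n h k => match n with
       | 0%nat => a + b * x0 + c * y0 | 1%nat => b * h + c * k | _ => 0 end).
  pose proof (Rabs_pos (a + b * x0 + c * y0)).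
  pose proof (Rabs_pos b). pose proof (Rabs_pos c).
  split; [lra | split].
  - intros n. rewrite pow1, Rmult_1_r. destruct n as [|[|n]].
    + apply (homog_monomial 0 0 (a + b * x0 + c * y0)); [lra | intros; ring].
    + apply (homog_add 1 (Rabs b) (Rabs c) _ (fun h _ => b * h) (fun _ k => c * k));
        [ | | lra | reflexivity].
      * apply (homog_monomial 1 0 b); [lra | intros; ring].
      * apply (homog_monomial 0 1 c); [lra | intros; ring].
    + apply homog_zero; [lra | reflexivity].
  - intros h k _ _.
    replace (a + b * (x0 + h) + c * (y0 + k)) with
      (sum_n (fun n => match n with
         | 0%nat => a + b * x0 + c * y0 | 1%nat => b * h + c * k | _ => 0 end) 1).
    + apply is_series_finite. intros [|[|n]] Hn; [lia | lia | reflexivity].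
    + rewrite sum_Sn, sum_O. unfold plus; simpl. ring.
Qed.

Lemma analytic_const a : analytic (fun _ _ => a).
Proof.
  apply analytic_ext with (2 := analytic_affine a 0 0). intros. ring.
Qed.

Lemma analytic_exp_snd : analytic (fun _ y => exp y).
Proof.
  intros x0 y0.
  (* Bounding [1 / n!] by 1 already gives a geometric estimate, at the price of restricting the
     expansion to [|k| < 1]. *)
  exists (exp y0), 1, (fun n h k => exp y0 * (/ INR (Factorial.fact n) * k ^ n)).
  split; [lra | split].
  - intros n. apply (homog_monomial 0 n (exp y0 * / INR (Factorial.fact n))).
    + rewrite pow1. pose proof (exp_pos y0) as He.
      assert (Hf : 1 <= INR (Factorial.fact n)).
      { apply (le_INR 1). pose proof (Factorial.lt_O_fact n). lia. }
      rewrite Rabs_pos_eq.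
      * apply Rmult_le_compat_l; [lra|]. rewrite <- Rinv_1.
        apply Rinv_le_contravar; lra.
      * apply Rmult_le_pos; [lra|]. apply Rlt_le, Rinv_0_lt_compat. lra.
    + intros. ring.
  - intros h k _ _. rewrite exp_plus.
    apply (is_series_scal (V := R_NormedModule) (exp y0)
             (fun n => / INR (Factorial.fact n) * k ^ n) (exp k)).
    apply is_series_ext with (2 := is_exp_Reals k).
    intros n. rewrite pow_n_pow. apply Rmult_comm.
Qed.

(** * Reciprocals *)

(* The homogeneous components of [1 / f], for a function [f] with components
   [p n], [p 0 = a]; row [n] of the table is correct up to index [n]. *)
Fixpoint inv_table (a : R) (p : nat -> R) (n m : nat) : R :=
  match n with
  | 0%nat => / a
  | S n' =>
      if Nat.leb m n' then inv_table a p n' m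
      else - / a * sum_f_R0 (fun j => p (S j) * inv_table a p n' (n' - j)) n'
  end.

Lemma inv_table_diag a p n m :
  (m <= n)%nat -> inv_table a p n m = inv_table a p m m.
Proof.
  intros H. induction H as [|n H IH]; [reflexivity|].
  simpl. destruct (Nat.leb_spec m n); [assumption | lia].
Qed.

(** On the diagonal, the structural recursion over rows becomes the course-of-values recursion for
    the reciprocal of a power series. *)
Lemma inv_table_rec a p n :
  inv_table a p (S n) (S n) =
  - / a * sum_f_R0 (fun j => p (S j) * inv_table a p (n - j) (n - j)) n.
Proof.
  cbn [inv_table]. rewrite (proj2 (Nat.leb_nle (S n) n)) by lia.
  f_equal. apply sum_eq. intros j Hj. now rewrite inv_table_diag by lia.
Qed.

Lemma inv_table_conv a p n :
  a <> 0 -> p 0%nat = a ->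
  sum_f_R0 (fun m => p m * inv_table a p (n - m) (n - m)) n =
  match n with 0%nat => 1 | S _ => 0 end.
Proof.
  intros Ha Hp. destruct n as [|n].
  - simpl. rewrite Hp. now apply Rinv_r.
  - rewrite decomp_sum by lia. rewrite Nat.sub_0_r, inv_table_rec, Hp.
    simpl Nat.pred. rewrite <- Rmult_assoc.
    replace (a * - / a) with (-1) by now field.
    match goal with |- -1 * ?s + ?t = 0 => replace t with s; [ring|] end.
    apply sum_eq. intros. now rewrite Nat.sub_succ.
Qed.

Lemma geom_convolution (r s : R) n :
  sum_f_R0 (fun j => (s - r) * r ^ j * s ^ (n - j)) n = s ^ S n - r ^ S n.
Proof.
  induction n as [|n IH].
  - simpl. ring.
  - rewrite tech5, Nat.sub_diag.
    rewrite (sum_eq _ (fun j => (s - r) * r ^ j * s ^ (n - j) * s)).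
    + rewrite <- scal_sum, IH. simpl. ring.
    + intros j Hj. replace (S n - j)%nat with (S (n - j)) by lia. simpl. ring.
Qed.

(** With [A = 1 / |a|], the growth rate [L] is chosen so that [L - K = M * A * K]. The recursion
    then bounds the norm in degree [n + 1] by [A] times the sum in [geom_convolution], that is by
    [A * (L ^ (n + 1) - K ^ (n + 1))]. *)
Lemma inv_table_homog M K a (p : nat -> R -> R -> R) :
  a <> 0 -> 0 < K -> (forall n, homog n (M * K ^ n) (p n)) ->
  forall n, homog n (/ Rabs a * (K * (1 + M * / Rabs a)) ^ n)
                  (fun h k => inv_table a (fun n => p n h k) n n).
Proof.
  intros Ha HK Hp. set (A := / Rabs a). set (L := K * (1 + M * A)).
  assert (HA : 0 < A) by now apply Rinv_0_lt_compat, Rabs_pos_lt.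
  assert (HM : 0 <= M).
  { pose proof (homog_ge0 _ _ _ (Hp 0%nat)) as H. simpl in H. lra. }
  intros n. induction n as [n IH] using lt_wf_ind. destruct n as [|n].
  - apply (homog_monomial 0 0 (/ a)).
    + rewrite Rabs_inv. simpl. fold A. lra.
    + intros. simpl. ring.
  - apply homog_weaken with
      (c := Rabs (- / a) *
            sum_f_R0 (fun j => M * K ^ S j * (A * L ^ (n - j))) n)
      (p := fun h k => - / a * sum_f_R0 (fun j => p (S j) h k *
              inv_table a (fun n => p n h k) (n - j) (n - j)) n).
    + apply homog_scal.
      apply homog_sum with (p := fun j h k => p (S j) h k *
        inv_table a (fun n => p n h k) (n - j) (n - j)).
      intros j Hj. replace (S n) with (S j + (n - j))%nat at 1 by lia.
      apply (homog_mult (S j) (n - j)); [apply Hp | apply IH; lia].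
    + rewrite Rabs_Ropp, Rabs_inv. fold A.
      apply Rmult_le_compat_l; [lra|].
      rewrite (sum_eq _ (fun j => (L - K) * K ^ j * L ^ (n - j))).
      * rewrite geom_convolution. pose proof (pow_lt K (S n) HK). lra.
      * intros. unfold L at 2. simpl. ring.
    + intros. apply inv_table_rec.
Qed.

(** At the origin [homog_bound] with [m = 0] kills every component of positive degree. *)
Lemma is_series_homog_origin M K (p : nat -> R -> R -> R) l :
  (forall n, homog n (M * K ^ n) (p n)) ->
  is_series (fun n => p n 0 0) l -> p 0%nat 0 0 = l.
Proof.
  intros Hp Hs. apply is_series_unique in Hs. rewrite <- Hs.
  symmetry. apply is_series_unique.
  rewrite <- (sum_O (fun n => p n 0 0)).
  apply is_series_finite. intros [|n] Hn; [lia|].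
  pose proof (homog_bound _ _ _ 0 0 0 (Hp (S n))) as H.
  rewrite Rabs_R0 in H. specialize (H (Rle_refl 0) (Rle_refl 0)).
  rewrite pow_i, Rmult_0_r in H by lia.
  pose proof (Rabs_pos (p (S n) 0 0)).
  destruct (Req_dec (p (S n) 0 0) 0) as [|Hne]; [assumption|].
  apply Rabs_pos_lt in Hne. lra.
Qed.

Lemma homog_0_const c p h k : homog 0 c p -> p h k = p 0 0.
Proof.
  intros Hp. remember 0%nat as n eqn:Hn.
  induction Hp as [i j a c p Ha Hp | n c d e p q r _ IHp _ IHq _ Hr].
  - assert (i = 0%nat) as -> by lia. assert (j = 0%nat) as -> by lia.
    rewrite !Hp. simpl. ring.
  - rewrite !Hr, IHp, IHq by assumption. reflexivity.
Qed.

(** The formal reciprocal converges absolutely because its norms grow geometrically; its Cauchy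
    product with the expansion of [f] is 1, which identifies its sum. *)
Lemma analytic_inv f :
  (forall x y, f x y <> 0) -> analytic f -> analytic (fun x y => / f x y).
Proof.
  intros Hf0 Hf x0 y0. destruct (Hf x0 y0) as (M & K & p & HK & Hp & Hs).
  set (a := f x0 y0). set (L := K * (1 + M * / Rabs a)).
  assert (Ha : a <> 0) by apply Hf0.
  assert (HM : 0 <= M).
  { pose proof (homog_ge0 _ _ _ (Hp 0%nat)) as H. simpl in H. lra. }
  assert (HA : 0 < / Rabs a) by now apply Rinv_0_lt_compat, Rabs_pos_lt.
  assert (HKL : K <= L).
  { unfold L. assert (0 <= M * / Rabs a) by (apply Rmult_le_pos; lra). nra. }
  assert (Hq := inv_table_homog M K a p Ha HK Hp). fold L in Hq.
  exists (/ Rabs a), L, (fun n h k => inv_table a (fun n => p n h k) n n).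
  split; [lra | split; [assumption|]].
  intros h k Hh Hk.
  assert (Hh' : K * Rabs h < 1) by (pose proof (Rabs_pos h); nra).
  assert (Hk' : K * Rabs k < 1) by (pose proof (Rabs_pos k); nra).
  (* The table starts from the value of [f] at the centre, while the convolution needs the degree 0
     component at [(h, k)]; both are the same constant. *)
  assert (Hp0 : p 0%nat h k = a).
  { rewrite (homog_0_const _ _ h k (Hp 0%nat)).
    apply (is_series_homog_origin M K); [assumption|].
    replace a with (f (x0 + 0) (y0 + 0)) by now rewrite !Rplus_0_r.
    apply Hs; rewrite Rabs_R0; lra. }
  set (q := fun n => inv_table a (fun n => p n h k) n n).
  assert (Habs : ex_series (fun n => Rabs (q n))).
  { apply (homog_ex_series _ (/ Rabs a) L h k) in Hq; auto. lra. }
  destruct (ex_series_Rabs _ Habs) as [l Hl].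
  replace (/ f (x0 + h) (y0 + k)) with l; [assumption|].
  assert (Hprod : f (x0 + h) (y0 + k) * l = 1).
  { pose proof (is_series_mult _ _ _ _ (Hs h k Hh' Hk') Hl
      (homog_ex_series p M K h k HK Hp Hh' Hk') Habs) as Hc.
    apply is_series_unique in Hc. rewrite <- Hc. apply is_series_unique.
    set (delta := fun n : nat => match n with 0%nat => 1 | S _ => 0 end).
    apply is_series_ext with delta.
    - intros n. symmetry. now apply (inv_table_conv a (fun n => p n h k) n).
    - pose proof (is_series_finite delta 0) as Hd. rewrite sum_O in Hd.
      apply Hd. intros [|n] Hn; [lia | reflexivity]. }
  apply Rmult_eq_reg_l with (f (x0 + h) (y0 + k)); [|apply Hf0].
  now rewrite Hprod, Rinv_r.
Qed.

(** * The perturbed surface *)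

Definition sech (y : R) : R := / cosh y.
(* [cs] and [sn] are the cosine and sine of the angle [theta] with
   [tan (theta / 2) = x * sech y]. *)
Definition cs (x y : R) : R := (cosh y ^ 2 - x ^ 2) / (cosh y ^ 2 + x ^ 2).
Definition sn (x y : R) : R := 2 * x * cosh y / (cosh y ^ 2 + x ^ 2).

Lemma cosh_pos y : 0 < cosh y.
Proof.
  unfold cosh. pose proof (exp_pos y). pose proof (exp_pos (- y)). lra.
Qed.

Lemma cosh_sqr y : cosh y ^ 2 = 1 + sinh y ^ 2.
Proof.
  unfold cosh, sinh. rewrite exp_Ropp. field. apply Rgt_not_eq, exp_pos.
Qed.

Lemma cosh_sqr_plus_pos x y : 0 < cosh y ^ 2 + x ^ 2.
Proof. pose proof (cosh_pos y). nra. Qed.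

Lemma sech_pos y : 0 < sech y.
Proof. apply Rinv_0_lt_compat, cosh_pos. Qed.

Lemma sech_sqr y : sech y ^ 2 = 1 - tanh y ^ 2.
Proof.
  pose proof (cosh_pos y). unfold sech, tanh.
  field_simplify_eq; [|lra]. rewrite cosh_sqr. ring.
Qed.

Lemma sn_sqr x y : sn x y ^ 2 = 1 - cs x y ^ 2.
Proof.
  pose proof (cosh_sqr_plus_pos x y). unfold sn, cs. field. lra.
Qed.

Lemma one_plus_cs_pos x y : 0 < 1 + cs x y.
Proof.
  pose proof (cosh_sqr_plus_pos x y) as H. pose proof (cosh_pos y).
  replace (1 + cs x y) with (2 * cosh y ^ 2 * / (cosh y ^ 2 + x ^ 2))
    by (unfold cs; field; lra).
  apply Rinv_0_lt_compat in H. apply Rmult_lt_0_compat; [nra | assumption].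
Qed.

(** The half-angle formula [tan (theta / 2) = s / (1 + c)]. It eliminates [x], leaving identities in
    [c], [s], [q] and [tanh y] modulo [sn_sqr] and [sech_sqr]. *)
Lemma x_eq x y : x = sn x y / ((1 + cs x y) * sech y).
Proof.
  pose proof (cosh_sqr_plus_pos x y). pose proof (cosh_pos y).
  unfold cs, sn, sech. field. split; [lra|split]; nra.
Qed.

Lemma is_derive_cosh y : is_derive cosh y (sinh y).
Proof. apply is_derive_Reals, derivable_pt_lim_cosh. Qed.

Lemma is_derive_sinh y : is_derive sinh y (cosh y).
Proof. apply is_derive_Reals, derivable_pt_lim_sinh. Qed.

Ltac derive_hyperbolic y :=
  pose proof (cosh_pos y);
  auto_derive;
  [ repeat split; try (eexists; first [apply is_derive_cosh | apply is_derive_sinh]);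
    try lra; auto using Rgt_not_eq, cosh_sqr_plus_pos
  | rewrite ?(is_derive_unique _ _ _ (is_derive_cosh y)),
            ?(is_derive_unique _ _ _ (is_derive_sinh y)) ].

Lemma is_derive_sech y : is_derive sech y (- sech y * tanh y).
Proof.
  unfold sech, tanh. derive_hyperbolic y. field. lra.
Qed.

Lemma is_derive_tanh y : is_derive tanh y (sech y ^ 2).
Proof.
  unfold sech, tanh. derive_hyperbolic y.
  field_simplify_eq; [|lra]. rewrite cosh_sqr. ring.
Qed.

(** Differentiating [tan (theta / 2) = x q] gives [theta_x = q (1 + c)] and [theta_y = - s tanh y].
    This formula and the next three are the resulting chain rules, verified on the rational
    expressions. *)
Lemma is_derive_cs_x x y :
  is_derive (fun t => cs t y) x (- sech y * sn x y * (1 + cs x y)).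
Proof.
  pose proof (cosh_sqr_plus_pos x y).
  unfold cs, sn, sech. derive_hyperbolic y. field. split; lra.
Qed.

Lemma is_derive_sn_x x y :
  is_derive (fun t => sn t y) x (sech y * cs x y * (1 + cs x y)).
Proof.
  pose proof (cosh_sqr_plus_pos x y).
  unfold cs, sn, sech. derive_hyperbolic y. field. split; lra.
Qed.

Lemma is_derive_cs_y x y : is_derive (cs x) y (tanh y * sn x y ^ 2).
Proof.
  pose proof (cosh_sqr_plus_pos x y).
  unfold cs, sn, tanh. derive_hyperbolic y. field. split; lra.
Qed.

Lemma is_derive_sn_y x y : is_derive (sn x) y (- tanh y * cs x y * sn x y).
Proof.
  pose proof (cosh_sqr_plus_pos x y).
  unfold cs, sn, tanh. derive_hyperbolic y. field. split; lra.
Qed.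

(** * A differential algebra containing the surface *)

(* Polynomial expressions in [x], [sech y], [tanh y], [cs] and [sn]: this algebra is
   closed under both partial derivatives. *)
Inductive term : Type :=
| Const (a : R)
| X | Sech | Tanh | Cs | Sn
| Plus (p q : term)
| Times (p q : term).

Fixpoint eval (p : term) (x y : R) : R :=
  match p with
  | Const a => a
  | X => x
  | Sech => sech y
  | Tanh => tanh y
  | Cs => cs x y
  | Sn => sn x y
  | Plus p q => eval p x y + eval q x y
  | Times p q => eval p x y * eval q x y
  end.

Declare Scope term_scope.
Delimit Scope term_scope with term.
Bind Scope term_scope with term.
Local Notation "p + q" := (Plus p q) : term_scope.
Local Notation "p * q" := (Times p q) : term_scope.
Local Notation "p - q" := (Plus p (Times (Const (-1)) q)) : term_scope.
Local Notation "- p" := (Times (Const (-1)) p) : term_scope.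
Local Notation "p ²" := (Times p p) (at level 1, format "p ²") : term_scope.
Local Notation "1" := (Const 1) : term_scope.

Fixpoint dx (p : term) : term :=
  match p with
  | X => 1
  | Cs => - Sech * Sn * (1 + Cs)
  | Sn => Sech * Cs * (1 + Cs)
  | Plus p q => dx p + dx q
  | Times p q => dx p * q + p * dx q
  | _ => Const 0
  end.

Fixpoint dy (p : term) : term :=
  match p with
  | Sech => - Sech * Tanh
  | Tanh => Sech * Sech
  | Cs => Tanh * (Sn * Sn)
  | Sn => - Tanh * Cs * Sn
  | Plus p q => dy p + dy q
  | Times p q => dy p * q + p * dy q
  | _ => Const 0
  end.

Lemma is_derive_eq (f : R -> R) (x l l' : R) : is_derive f x l -> l = l' -> is_derive f x l'.
Proof. now intros H <-. Qed.

Lemma is_derive_Rmult (f g : R -> R) (x a b : R) :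
  is_derive f x a -> is_derive g x b ->
  is_derive (fun t => f t * g t) x (a * g x + f x * b).
Proof. intros Hf Hg. apply (is_derive_mult f g x a b Hf Hg Rmult_comm). Qed.

Lemma is_derive_eval_x p (x y : R) : is_derive (fun t => eval p t y) x (eval (dx p) x y).
Proof.
  induction p as [a | | | | | | p IHp q IHq | p IHp q IHq]; cbn [eval dx];
    try apply (is_derive_const (V := R_NormedModule)).
  - apply (is_derive_id (K := R_AbsRing)).
  - apply is_derive_eq with (1 := is_derive_cs_x x y). ring.
  - apply is_derive_eq with (1 := is_derive_sn_x x y). ring.
  - exact (is_derive_plus _ _ _ _ _ IHp IHq).
  - apply (is_derive_Rmult (fun t => eval p t y) (fun t => eval q t y)); assumption.
Qed.

Lemma is_derive_eval_y p (x y : R) : is_derive (eval p x) y (eval (dy p) x y).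
Proof.
  induction p as [a | | | | | | p IHp q IHq | p IHp q IHq]; cbn [dy eval];
    try apply (is_derive_const (V := R_NormedModule)).
  - apply is_derive_eq with (1 := is_derive_sech y). ring.
  - apply is_derive_eq with (1 := is_derive_tanh y). ring.
  - apply is_derive_eq with (1 := is_derive_cs_y x y). ring.
  - apply is_derive_eq with (1 := is_derive_sn_y x y). ring.
  - exact (is_derive_plus _ _ _ _ _ IHp IHq).
  - apply (is_derive_Rmult (eval p x) (eval q x)); assumption.
Qed.

Lemma d_x_eval p : d_x (eval p) = eval (dx p).
Proof.
  extensionality x. extensionality y. apply is_derive_unique, is_derive_eval_x.
Qed.

Lemma d_y_eval p : d_y (eval p) = eval (dy p).
Proof.
  extensionality x. extensionality y. apply is_derive_unique, is_derive_eval_y.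
Qed.

Lemma d_xx_eval p : d_xx (eval p) = eval (dx (dx p)).
Proof. rewrite <- !d_x_eval. reflexivity. Qed.

Lemma d_xy_eval p : d_xy (eval p) = eval (dx (dy p)).
Proof. rewrite <- d_x_eval, <- d_y_eval. reflexivity. Qed.

Lemma d_yy_eval p : d_yy (eval p) = eval (dy (dy p)).
Proof. rewrite <- !d_y_eval. reflexivity. Qed.

(** * Analyticity and boundedness of terms *)

Lemma analytic_inv_exp : analytic (fun _ y => exp (- y)).
Proof.
  apply analytic_ext with (fun _ y => / exp y).
  - intros. now rewrite exp_Ropp.
  - apply (analytic_inv (fun _ y => exp y)); [|apply analytic_exp_snd].
    intros. apply Rgt_not_eq, exp_pos.
Qed.

Lemma analytic_cosh : analytic (fun _ y => cosh y).
Proof.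
  apply analytic_ext with (fun _ y => (exp y + exp (- y)) * (1 / 2)).
  - intros. unfold cosh. field.
  - apply analytic_mult; [|apply analytic_const].
    apply analytic_plus; [apply analytic_exp_snd | apply analytic_inv_exp].
Qed.

Lemma analytic_sinh : analytic (fun _ y => sinh y).
Proof.
  apply analytic_ext with (fun _ y => (exp y + -1 * exp (- y)) * (1 / 2)).
  - intros. unfold sinh. field.
  - apply analytic_mult; [|apply analytic_const].
    apply analytic_plus; [apply analytic_exp_snd|].
    apply analytic_mult; [apply analytic_const | apply analytic_inv_exp].
Qed.

Lemma analytic_sech : analytic (fun _ y => sech y).
Proof.
  apply (analytic_inv (fun _ y => cosh y)); [|apply analytic_cosh].
  intros. apply Rgt_not_eq, cosh_pos.
Qed.

Lemma analytic_fst : analytic (fun x _ => x).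
Proof.
  apply analytic_ext with (2 := analytic_affine 0 1 0). intros. ring.
Qed.

Lemma analytic_inv_cosh_sqr_plus : analytic (fun x y => / (cosh y * cosh y + x * x)).
Proof.
  apply (analytic_inv (fun x y => cosh y * cosh y + x * x)).
  - intros x y. pose proof (cosh_pos y). nra.
  - apply analytic_plus; apply analytic_mult;
      first [apply analytic_cosh | apply analytic_fst].
Qed.

Lemma analytic_eval p : analytic (eval p).
Proof.
  induction p as [a | | | | | | p IHp q IHq | p IHp q IHq].
  - apply analytic_const.
  - apply analytic_fst.
  - apply analytic_sech.
  - apply analytic_ext with (fun _ y => sinh y * sech y); [reflexivity|].
    apply analytic_mult; [apply analytic_sinh | apply analytic_sech].
  - apply analytic_ext with (fun x y =>
      (cosh y * cosh y + -1 * (x * x)) * / (cosh y * cosh y + x * x)).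
    + intros x y. pose proof (cosh_sqr_plus_pos x y). simpl. unfold cs. field. nra.
    + apply analytic_mult; [|apply analytic_inv_cosh_sqr_plus].
      apply analytic_plus; [apply analytic_mult; apply analytic_cosh|].
      apply analytic_mult; [apply analytic_const|].
      apply analytic_mult; apply analytic_fst.
  - apply analytic_ext with (fun x y =>
      2 * (x * cosh y) * / (cosh y * cosh y + x * x)).
    + intros x y. pose proof (cosh_sqr_plus_pos x y). simpl. unfold sn. field. nra.
    + apply analytic_mult; [|apply analytic_inv_cosh_sqr_plus].
      apply analytic_mult; [apply analytic_const|].
      apply analytic_mult; [apply analytic_fst | apply analytic_cosh].
  - now apply analytic_plus.
  - now apply analytic_mult.
Qed.

Fixpoint x_free (p : term) : Prop :=
  match p with
  | X => False
  | Plus p q | Times p q => x_free p /\ x_free q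
  | _ => True
  end.

(* Every atom other than [X] takes its values in [-1, 1]. *)
Fixpoint weight (p : term) : R :=
  match p with
  | Const a => Rabs a
  | Plus p q => weight p + weight q
  | Times p q => weight p * weight q
  | _ => 1
  end.

(** The pairs [(cs, sn)] and [(sech, tanh)] lie on the unit circle, which bounds the atoms. *)
Lemma eval_bound p x y : x_free p -> Rabs (eval p x y) <= weight p.
Proof.
  pose proof (sech_pos y). pose proof (sech_sqr y). pose proof (sn_sqr x y).
  induction p as [a | | | | | | p IHp q IHq | p IHp q IHq]; simpl; intros Hp;
    try apply Rle_refl; try contradiction; try (apply Rabs_le; nra).
  - apply Rle_trans with (1 := Rabs_triang _ _).
    apply Rplus_le_compat; tauto.
  - rewrite Rabs_mult. apply Rmult_le_compat; auto using Rabs_pos; tauto.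
Qed.

(** * The surface and the factorizations of B and N *)

(* Any [eps] small enough for [P_ge_half] would do. *)
Definition eps : R := 1 / 100.

Definition g_term : term := X * Tanh + Const eps * Sech * (Cs * Cs²).

Definition B_term : term := 1 - (dx g_term)² - (dy g_term)².

Definition N_term : term :=
  ((dx g_term)² - 1) * dy (dy g_term)
  - Const 2 * dx g_term * dy g_term * dx (dy g_term)
  + ((dy g_term)² - 1) * dx (dx g_term).

(** The deviation from 1 of the cofactor [P] in [B_factor]. It is quadratic in [eps], as B is in
    [g], and divisible by [c ^ 2]. *)
Definition P_dev : term :=
  Const eps * Tanh * Cs² * Sn * (Const 7 + Const 6 * Cs)
  - Const (eps ^ 2 / 2) * (Cs * Cs²) * (1 + Cs)
    * (Const 9 * Sech² * Sn² * (1 + Cs)² + Tanh² * (Cs - Const 3 * Sn²)²).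

Definition P_term : term := 1 + P_dev.

(** The cofactor in [N_factor], cubic in [eps] as N is in [g]. The term of degree 0 in [eps] is
    absent because the graph of [x tanh y] has zero mean curvature. *)
Definition R_term : term :=
  Const eps * (- Const 9 - Const 17 * Cs + Const 15 * Cs² + Const 24 * (Cs * Cs²))
  + Const (6 * eps ^ 2) * Sn * Tanh * Cs² * (1 + Cs * Cs² + Tanh² * Cs * (1 + Cs))
  + Const (3 * eps ^ 3) * Sech² * (Cs²)² *
    (Const 9 + (Const 15 - Const 4 * Tanh²) * Cs
     - (Const 15 + Const 7 * Tanh²) * Cs² - Const 36 * (Cs * Cs²)
     + (Const 5 * Tanh² - Const 3) * (Cs²)²
     + (Const 21 + Const 2 * Tanh²) * (Cs * (Cs²)²) + Const 9 * (Cs² * (Cs²)²)).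

Lemma P_ge_half x y : 1 / 2 <= eval P_term x y.
Proof.
  assert (H : Rabs (eval P_dev x y) <= 1 / 2).
  { apply Rle_trans with (weight P_dev).
    - apply eval_bound. simpl. tauto.
    (* The weight is [13 * eps + 52 * eps ^ 2]. *)
    - simpl. unfold eps.
      repeat first [rewrite Rabs_pos_eq by lra | rewrite Rabs_left by lra]. lra. }
  apply Rabs_le_between in H. cbn [eval P_term]. lra.
Qed.

Lemma B_factor x y :
  eval B_term x y = 2 * cs x y * sech y ^ 2 * eval P_term x y / (1 + cs x y).
Proof.
  pose proof (x_eq x y) as Hx. pose proof (sech_sqr y) as Hq.
  pose proof (sn_sqr x y) as Hs.
  pose proof (one_plus_cs_pos x y). pose proof (sech_pos y).
  cbn -[eps tanh].
  (* The atoms become indeterminates tied only by the two quadratic relations, modulo which [field]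
     compares both sides. *)
  generalize dependent (sech y). generalize dependent (cs x y).
  generalize dependent (sn x y). generalize dependent (tanh y). generalize eps.
  intros e t s c Hs Hc q Hx Hq Hqp.
  rewrite Hx. field [Hs Hq]. lra.
Qed.

Lemma N_factor x y :
  eval N_term x y = sech y ^ 3 * cs x y ^ 2 * eval R_term x y.
Proof.
  pose proof (x_eq x y) as Hx. pose proof (sech_sqr y) as Hq.
  pose proof (sn_sqr x y) as Hs.
  pose proof (one_plus_cs_pos x y). pose proof (sech_pos y).
  cbn -[eps tanh].
  generalize dependent (sech y). generalize dependent (cs x y).
  generalize dependent (sn x y). generalize dependent (tanh y). generalize eps.
  intros e t s c Hs Hc q Hx Hq Hqp.
  rewrite Hx. field [Hs Hq]. lra.
Qed.

Definition g : R -> R -> R := eval g_term.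

Lemma B_g x y : B g x y = eval B_term x y.
Proof.
  unfold B, g. rewrite d_x_eval, d_y_eval. unfold B_term. cbn [eval]. ring.
Qed.

Lemma B_g_fun : B g = eval B_term.
Proof. extensionality x. extensionality y. apply B_g. Qed.

(** In [B_factor] every factor other than [c] is positive. *)
Lemma B_g_zero x y : B g x y = 0 <-> cs x y = 0.
Proof.
  rewrite B_g, B_factor.
  pose proof (one_plus_cs_pos x y) as Hc. pose proof (sech_pos y) as Hq.
  pose proof (P_ge_half x y) as HP.
  split; intros H0.
  - set (p := eval P_term x y) in *. set (q := sech y) in *.
    replace (cs x y) with (2 * cs x y * q ^ 2 * p / (1 + cs x y)
      * ((1 + cs x y) / (2 * q ^ 2 * p))) by (field; repeat split; lra).
    rewrite H0. ring.
  - rewrite H0. field.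
Qed.

(** Every zero of B is a non-degenerate point of type change: there [s ^ 2 = 1], so [B_x] does not
    vanish. *)
Lemma Sigma_g x y : Sigma g x y <-> cs x y = 0.
Proof.
  unfold Sigma. rewrite B_g_zero. split; [tauto|]. intros H0. split; [assumption|].
  intros Heq. apply (f_equal fst) in Heq. simpl in Heq.
  rewrite B_g_fun, d_x_eval in Heq.
  pose proof (x_eq x y) as Hx. pose proof (sech_sqr y) as Hq.
  pose proof (sn_sqr x y) as Hs. pose proof (sech_pos y) as Hqp.
  rewrite H0 in Hx, Hs.
  (* On [c = 0] one has [P = 1] and [c_x = - q s], hence [B_x = 2 q ^ 2 c_x]. *)
  assert (Hd : eval (dx B_term) x y = - 2 * sn x y * sech y ^ 3).
  { cbn -[eps tanh]. rewrite H0.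
    clear Heq. generalize dependent (sech y). generalize dependent (sn x y).
    intros s Hs q Hx Hq Hqp. rewrite Hx. field [Hs Hq]. lra. }
  rewrite Hd in Heq.
  assert (Hn : sn x y <> 0) by (intros E; rewrite E in Hs; lra).
  apply Rmult_integral in Heq as [E|E]; [lra|].
  pose proof (pow_lt _ 3 Hqp). lra.
Qed.

(** * Induced metric and mean curvature of the graph *)

Lemma induced_metric_eq f x y u v :
  induced_metric f x y u v =
  - ((d_x f x y * fst u + d_y f x y * snd u)
     * (d_x f x y * fst v + d_y f x y * snd v))
  + fst u * fst v + snd u * snd v.
Proof.
  assert (Hxx : d_x (fun x _ => x) x y = 1) by apply Derive_id.
  assert (Hxy : d_y (fun x _ => x) x y = 0) by exact (Derive_const x y).
  assert (Hyx : d_x (fun _ y => y) x y = 0) by exact (Derive_const y x).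
  assert (Hyy : d_y (fun _ y => y) x y = 1) by apply Derive_id.
  unfold induced_metric, Defs.differential, lorentz, graph, coord_t, coord_x, coord_y.
  cbn [fst snd]. rewrite Hxx, Hxy, Hyx, Hyy.
  change (fun x y => f x y) with f. ring.
Qed.

(** A vector [u] in the kernel of the metric satisfies [u = w * grad f], where [w] is the pairing of
    [grad f] with [u]. Pairing with [grad f] again gives [w * B = 0], so [w = 0] and [u = 0]. *)
Lemma induced_metric_nondegenerate_of_B f x y :
  B f x y <> 0 -> induced_metric_nondegenerate f x y.
Proof.
  intros HB [u1 u2] Hu.
  pose proof (Hu (1, 0)) as H1. pose proof (Hu (0, 1)) as H2.
  rewrite induced_metric_eq in H1, H2. simpl in H1, H2. unfold B in HB.
  set (a := d_x f x y) in *. set (b := d_y f x y) in *.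
  assert (Ha : (a * u1 + b * u2) * (1 - a ^ 2 - b ^ 2) = 0).
  { assert (E1 : (a * u1 + b * u2) * a = u1) by lra.
    assert (E2 : (a * u1 + b * u2) * b = u2) by lra.
    transitivity (a * u1 + b * u2
      - a * ((a * u1 + b * u2) * a) - b * ((a * u1 + b * u2) * b)); [ring|].
    rewrite E1, E2. ring. }
  apply Rmult_integral in Ha as [Ha|Ha]; [|contradiction].
  rewrite Ha in H1, H2. f_equal; lra.
Qed.

Lemma Rpower_3_2 b : 0 < b -> Rpower b (3 / 2) = b * sqrt b.
Proof.
  intros Hb. replace (3 / 2) with (1 + / 2) by field.
  now rewrite Rpower_plus, Rpower_1, Rpower_sqrt.
Qed.

Lemma mean_curvature_g x y :
  mean_curvature g x y =
  eval N_term x y / (2 * Rpower (Rabs (B g x y)) (3 / 2)).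
Proof.
  unfold mean_curvature, g.
  rewrite d_x_eval, d_y_eval, d_xx_eval, d_xy_eval, d_yy_eval.
  unfold N_term, Rdiv. f_equal. cbn [eval]. ring.
Qed.

(** From [q ^ 2 |c| <= 4 |B|] follows [q ^ 3 |c| ^ (3/2) <= 8 |B| ^ (3/2)]. The remaining
    [|c| ^ (1/2)] in N is at most 1, so [|H|] is at most [8 / 2] times the bound of [R]. The square
    roots [r] of [|c|] and [z] of [|B|] make these estimates polynomial. *)
Lemma mean_curvature_g_bound x y :
  cs x y <> 0 -> Rabs (mean_curvature g x y) <= 4 * weight R_term.
Proof.
  intros Hc. assert (HB : B g x y <> 0) by now rewrite B_g_zero.
  pose proof (Rabs_pos_lt _ HB) as Hb.
  rewrite mean_curvature_g, Rpower_3_2 by assumption.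
  set (b := Rabs (B g x y)) in *.
  assert (HR : Rabs (eval R_term x y) <= weight R_term)
    by (apply eval_bound; simpl; tauto).
  set (q := sech y) in *. assert (Hq : 0 < q) by apply sech_pos.
  set (r := sqrt (Rabs (cs x y))).
  assert (Hr : 0 <= r) by apply sqrt_pos.
  assert (Hr2 : r * r = Rabs (cs x y)) by apply sqrt_sqrt, Rabs_pos.
  assert (Hc1 : Rabs (cs x y) <= 1) by exact (eval_bound Cs x y I).
  assert (Hz : 0 < sqrt b) by now apply sqrt_lt_R0.
  assert (Hz2 : sqrt b * sqrt b = b) by (apply sqrt_sqrt; lra).
  set (z := sqrt b) in *.
  (* Here [|B| = q ^ 2 |c| * 2 P / (1 + c)], and the last quotient is at least [1 / 2] since
     [P >= 1 / 2] and [1 + c <= 2]. *)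
  assert (Hbz : q ^ 2 * (r * r) <= 4 * (z * z)).
  { rewrite Hz2, Hr2. unfold b. rewrite B_g, B_factor.
    pose proof (one_plus_cs_pos x y) as Hp. pose proof (P_ge_half x y) as HP.
    assert (Hp2 : 1 + cs x y <= 2) by (apply Rabs_le_between in Hc1; lra).
    fold q. replace (2 * cs x y * q ^ 2 * eval P_term x y / (1 + cs x y)) with
      (cs x y * (q ^ 2 * (2 * eval P_term x y / (1 + cs x y)))) by (field; lra).
    assert (Hk : 1 / 2 <= 2 * eval P_term x y / (1 + cs x y)).
    { apply Rmult_le_reg_r with (1 + cs x y); [assumption|].
      replace (2 * eval P_term x y / (1 + cs x y) * (1 + cs x y))
        with (2 * eval P_term x y) by (field; lra). lra. }
    rewrite Rabs_mult, (Rabs_pos_eq (q ^ 2 * _)).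
    - pose proof (Rabs_pos (cs x y)).
      assert (0 <= q ^ 2 * Rabs (cs x y)) by (apply Rmult_le_pos; nra). nra.
    - apply Rmult_le_pos; nra. }
  assert (Hqr : q * r <= 2 * z).
  { apply Rsqr_incr_0_var; unfold Rsqr; nra. }
  assert (Hqr3 : q ^ 3 * r ^ 3 <= 8 * z ^ 3).
  { rewrite <- Rpow_mult_distr. replace (8 * z ^ 3) with ((2 * z) ^ 3) by ring.
    apply pow_incr. split; [apply Rmult_le_pos; lra | assumption]. }
  assert (Hr1 : r <= 1) by nra.
  assert (HN : Rabs (eval N_term x y) <= 8 * z ^ 3 * weight R_term).
  { rewrite N_factor, Rabs_mult. fold q.
    apply Rmult_le_compat; auto using Rabs_pos.
    rewrite Rabs_mult, (Rabs_pos_eq (q ^ 3)) by (apply pow_le; lra).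
    rewrite <- RPow_abs, <- Hr2.
    apply Rle_trans with (2 := Hqr3).
    apply Rmult_le_compat_l; [apply pow_le; lra|].
    (* This is [r ^ 4 <= r ^ 3]. *)
    assert (0 <= r ^ 3) by now apply pow_le. simpl in *. nra. }
  rewrite <- Hz2. unfold Rdiv. rewrite Rabs_mult, Rabs_inv.
  rewrite (Rabs_pos_eq (2 * _)) by nra.
  apply Rmult_le_reg_r with (2 * (z * z * z)); [nra|].
  rewrite Rmult_assoc, Rinv_l by nra.
  replace (4 * weight R_term * (2 * (z * z * z))) with (8 * z ^ 3 * weight R_term)
    by ring. lra.
Qed.

(** * Extension of the mean curvature vector field *)

(* [N / (2 B ^ 2)], with the common factors [cs ^ 2] and [sech ^ 3] cancelled. *)
Definition H_nu_coef (x y : R) : R :=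
  eval (R_term * ((1 + Cs) * (1 + Cs)) * Const (1 / 8))%term x y
  * (/ eval Sech x y * (/ eval P_term x y * / eval P_term x y)).

Definition H_nu (x y : R) : R31 :=
  scale (H_nu_coef x y) (1, eval (dx g_term) x y, eval (dy g_term) x y).

Lemma analytic_H_nu_coef : analytic H_nu_coef.
Proof.
  assert (HP : analytic (fun x y => / eval P_term x y)).
  { apply analytic_inv; [|apply analytic_eval].
    intros x y. pose proof (P_ge_half x y). lra. }
  apply analytic_mult; [apply analytic_eval|].
  apply analytic_mult; [|now apply analytic_mult].
  apply analytic_inv; [|apply analytic_eval].
  intros x y. apply Rgt_not_eq, sech_pos.
Qed.

Lemma real_analytic_H_nu : real_analytic_map H_nu.
Proof.
  pose proof analytic_H_nu_coef as HV.
  repeat split; apply analytic_real_analytic;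
    unfold H_nu, scale, coord_t, coord_x, coord_y; cbn [fst snd];
    apply analytic_mult; first [exact HV | apply analytic_const | apply analytic_eval].
Qed.

(** The powers [3/2] in [H] and [1/2] in the unit normal multiply to [|B| ^ 2 = B ^ 2]. The absolute
    value disappears, so one analytic formula serves the space-like and the time-like side. *)
Lemma mean_curvature_vector_g x y :
  cs x y <> 0 -> H_nu x y = mean_curvature_vector g x y.
Proof.
  intros Hc. assert (HB : B g x y <> 0) by now rewrite B_g_zero.
  assert (Hcoef : H_nu_coef x y = mean_curvature g x y * / sqrt (Rabs (B g x y))).
  { pose proof (Rabs_pos_lt _ HB) as Hb.
    rewrite mean_curvature_g, Rpower_3_2 by assumption.
    set (b := Rabs (B g x y)) in *.
    assert (Hz : 0 < sqrt b) by now apply sqrt_lt_R0.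
    assert (Hz2 : sqrt b * sqrt b = b) by (apply sqrt_sqrt; lra).
    transitivity (eval N_term x y / (2 * (b * b))).
    - replace (b * b) with (B g x y * B g x y)
        by (unfold b; rewrite <- Rabs_mult, Rabs_pos_eq; nra).
      rewrite N_factor, B_g, B_factor. unfold H_nu_coef. cbn [eval].
      pose proof (one_plus_cs_pos x y). pose proof (P_ge_half x y).
      pose proof (sech_pos y). field. repeat split; lra.
    - set (z := sqrt b) in *. rewrite <- Hz2. field. lra. }
  unfold H_nu, mean_curvature_vector, unit_normal, scale, coord_t, coord_x, coord_y.
  cbn [fst snd]. rewrite Hcoef. unfold g. rewrite d_x_eval, d_y_eval.
  f_equal; [f_equal|]; ring.
Qed.

(** The time component of [H_nu] is [H_nu_coef] itself, so it suffices that this coefficient is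
    nonzero. *)
Lemma H_nu_neq0 x y : cs x y = 0 -> H_nu x y <> (0, 0, 0).
Proof.
  intros Hc HV. apply (f_equal coord_t) in HV.
  unfold H_nu, scale, coord_t, H_nu_coef in HV. cbn [fst] in HV.
  pose proof (P_ge_half x y). pose proof (sech_pos y).
  (* On [c = 0] the cofactor [R] equals [-9 * eps], and [1 + c = 1]. *)
  assert (HR : eval (R_term * ((1 + Cs) * (1 + Cs)) * Const (1 / 8))%term x y
               = - 9 / 800).
  { cbn -[tanh]. rewrite Hc. unfold eps. field. }
  rewrite HR in HV. rewrite Rmult_1_r in HV.
  apply Rmult_integral in HV as [HV|HV]; [lra|].
  revert HV. apply Rmult_integral_contrapositive_currified.
  - apply Rinv_neq_0_compat, Rgt_not_eq, sech_pos.
  - apply Rmult_integral_contrapositive_currified; apply Rinv_neq_0_compat; lra.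
Qed.

Theorem theorem1p2 :
  exists g : R -> R -> R,
    real_analytic g /\
    ((exists x y : R, Sigma g x y) /\
     (forall x y : R, ~ Sigma g x y -> induced_metric_nondegenerate g x y)) /\
    (exists M : R, forall x y : R,
       ~ Sigma g x y -> Rabs (mean_curvature g x y) <= M) /\
    (exists V : R -> R -> R31,
       real_analytic_map V /\
       (forall x y : R, ~ Sigma g x y -> V x y = mean_curvature_vector g x y) /\
       (forall x y : R, Sigma g x y -> V x y <> (0, 0, 0))).
Proof.
  exists g. split; [apply analytic_real_analytic, analytic_eval|].
  split; [split|split].
  (* The curve [c = 0] is [x = ± cosh y], and [cosh 0 = 1]. *)
  - exists 1, 0. apply Sigma_g. unfold cs. rewrite cosh_0. field.
  - intros x y H. rewrite Sigma_g in H.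
    apply induced_metric_nondegenerate_of_B. now rewrite B_g_zero.
  - exists (4 * weight R_term). intros x y H. rewrite Sigma_g in H.
    now apply mean_curvature_g_bound.
  - exists H_nu. split; [exact real_analytic_H_nu | split]; intros x y H;
      rewrite Sigma_g in H.
    + now apply mean_curvature_vector_g.
    + now apply H_nu_neq0.
Qed.
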